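(* Let $\mathcal{A}=\{a,b\}$ with $a$ the symbol with largest probability $p=p_a\ge\frac12$, and $p_b=1-p$. For holes of fixed length $r\ge2$, the maximal escape rate $\gamma_{max}^r:=\max\{\gamma_w:w\in\mathcal{A}^r\}$ satisfies: (i) If $p\in\left[\frac12,1-\frac1r\right)$ then $$\gamma_{max}^r\in\left[\log\bar\gamma(p,r),\ \frac1{r-1}\log\frac1{r\,p^{r-1}(1-p)}\right],$$ where, with $m=p^{r-1}(1-p)$, $$\bar\gamma(p,r)=\frac{1+r(r-2)m-\sqrt{1-rm(2+(r-2)m)}}{r(r-1)m}.$$ (ii) If $p\in\left[1-\frac1r,1-\frac1{r+1}\right]$ then $\gamma_{max}^r=\log\frac1p$. (iii) If $p\in\left(1-\frac1{r+1},1\right)$ then $$\gamma_{max}^r\in\left[\log\frac1p+\frac1r\log\frac1{(r+1)(1-p)},\ \log\left(\frac{-1+p+\sqrt{(1-p)^2+4p(1-p)}}{2p(1-p)}\right)\right].$$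
   Context: Let $\mathcal{A}=\{a,b\}$ with a probability vector $(p_a,p_b)$, $p_a,p_b>0$. Let $\mu$ be the product probability measure on $\mathcal{A}^{\mathbb{N}}$ (sequences $\omega=(\omega_0\omega_1\omega_2\dots)$) determined by this vector, and let $\sigma$ be the left shift. A word $w=(w_0w_1\dots w_{r-1})\in\mathcal{A}^r$ is identified with the hole $H=\{\omega\in\mathcal{A}^{\mathbb{N}}: \omega_i=w_i,\ 0\le i\le r-1\}$ of length $r$. Put $S_n=\{\omega:\sigma^i(\omega)\notin H,\ i=0,\dots,n\}$ and $p_n=\mu(S_n)$. The escape rate of $w$ is $\gamma_w:=\liminf_{n\to\infty}\frac{-\log p_n}{n}$. *)

(* Defs.v *)
From HB Require Import structures.
From mathcomp Require Import all_boot all_order all_algebra.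
From mathcomp Require Import all_classical all_reals all_analysis.

Set Implicit Arguments.
Unset Strict Implicit.
Unset Printing Implicit Defensive.

Import Order.TTheory GRing.Theory Num.Theory.

Local Open Scope classical_set_scope.
Local Open Scope ring_scope.

(* The alphabet {a, b} is bool, with a = true and b = false; thus
   bernoulli_pmf p is the probability vector p_a = p, p_b = 1 - p. *)

(* The hole identified with w when w is a word. *)
Definition cylinder (w : seq bool) : set (nat -> bool) :=
  [set x | forall i, (i < size w)%N -> x i = nth false w i].

(* {a, b}^nat with its product sigma-algebra. *)
Notation sequence_space := (g_sigma_algebraType (range cylinder)).

(* By the pi-lambda theorem at most one probability measure satisfies this;
   it exists whenever 0 <= p <= 1. *)
Definition is_product_measure (R : realType) (p : R)
    (mu : probability sequence_space R) : Prop :=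
  forall w : seq bool, mu (cylinder w) = (\prod_(x <- w) bernoulli_pmf p x)%:E.

Definition left_shift (x : sequence_space) : sequence_space := fun n => x n.+1.

Definition survivor (w : seq bool) (n : nat) : set sequence_space :=
  [set x | forall i, (i <= n)%N -> ~ cylinder w (iter i left_shift x)].

(* Extended real, so that no finiteness of the liminf and no positivity of
   the measure of the survivor sets is presupposed; the term of index 0 is
   irrelevant. *)
Definition escape_rate (R : realType) (mu : probability sequence_space R)
    (w : seq bool) : \bar R :=
  limn_einf (fun n => (- lne (mu (survivor w n)) / n%:R%:E)%E).

Definition max_escape_rate (R : realType) (mu : probability sequence_space R)
    (r : nat) : \bar R :=
  \big[maxe/-oo%E]_(w : r.-tuple bool) escape_rate mu w.

Definition gamma_bar (R : realType) (p : R) (r : nat) : R :=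
  let m := p ^+ r.-1 * (1 - p) in
  (1 + r%:R * (r%:R - 2) * m
     - Num.sqrt (1 - r%:R * m * (2 + (r%:R - 2) * m)))
  / (r%:R * (r%:R - 1) * m).

(* Main.v *)
Require Import Defs.
From HB Require Import structures.
From mathcomp Require Import all_boot all_order all_algebra.
From mathcomp Require Import all_classical all_reals all_analysis.
From mathcomp Require Import ring lra zify.
Import Order.TTheory GRing.Theory Num.Theory.
Import numFieldNormedType.Exports.
Local Open Scope classical_set_scope.
Local Open Scope ring_scope.

(* Let s(n) be the probability that a random word of length n avoids w, so that
   the survivor set S_n has measure s(n + r), and put q = 1 - p.
   - If w contains b then s(n) >= p^n, and w has weight at most m = p^(r-1) q.
     Splitting on an occurrence of w at the front gives
     s(n + r) >= s(n + r - 1) - m s(n), so s decays no faster than z^-n whenever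
     m z^r <= z - 1.  The upper bound in (i) is log z for the minimizer z of
     m z^r - z + 1; the minimum is nonpositive because 1/p is a root.
   - For w = a^r and w = a^(r-1) b, splitting at the first b gives recurrences
     with nonnegative coefficients, whose growth is read off from the polynomial
     sum_(i < k) q p^i z^(i+1), with k = r and k = r - 1.  The lower bounds come
     from a^(r-1) b in (i) and (ii), and from a^r in (iii).
   - gamma_bar is the smaller root of m z^r - z + 1 after z^r is truncated at
     second order at z = 1. *)

Set Implicit Arguments.
Unset Strict Implicit.
Unset Printing Implicit Defensive.

(** * Expectations over words of independent random letters *)

Fixpoint word_mean (R : realType) (p : R) (n : nat) (f : seq bool -> R) : R :=
  if n is n'.+1 then
    p * word_mean p n' (fun v => f (true :: v)) +
    (1 - p) * word_mean p n' (fun v => f (false :: v))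
  else f [::].

Definition avoid_prob (R : realType) (p : R) (w : seq bool) (n : nat) : R :=
  word_mean p n (fun v => (~~ infix w v)%:R).

Definition word_weight (R : realType) (p : R) (w : seq bool) : R :=
  \prod_(x <- w) bernoulli_pmf p x.

Section WordMean.
Variables (R : realType) (p : R).
Hypotheses (p_ge0 : 0 <= p) (p_le1 : p <= 1).
Implicit Types (f g : seq bool -> R) (w u v : seq bool) (n k N : nat).

Lemma eq_word_mean n f g :
  (forall v, size v = n -> f v = g v) -> word_mean p n f = word_mean p n g.
Proof.
elim: n f g => [|n IH] f g fg /=; first exact: fg.
by congr (_ * _ + _ * _); apply: IH => v sv; apply: fg; rewrite /= sv.
Qed.

Lemma ler_word_mean n f g :
  (forall v, size v = n -> f v <= g v) -> word_mean p n f <= word_mean p n g.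
Proof.
elim: n f g => [|n IH] f g fg /=; first exact: fg.
by apply: lerD; apply: ler_wpM2l; rewrite ?subr_ge0 //;
  apply: IH => v sv; apply: fg; rewrite /= sv.
Qed.

Lemma word_meanB n f g :
  word_mean p n (fun v => f v - g v) = word_mean p n f - word_mean p n g.
Proof. by elim: n f g => [|n IH] f g //=; rewrite !IH; ring. Qed.

Lemma word_mean_cst n (c : R) : word_mean p n (fun=> c) = c.
Proof. by elim: n => [|n IH] //=; rewrite IH; ring. Qed.

(** Independence: the first [size w] letters are prescribed and the remaining [n] are free. *)
Lemma word_mean_prefix w n f :
  word_mean p (size w + n)
    (fun v => (prefix w v)%:R * f (drop (size w) v)) =
  word_weight p w * word_mean p n f.
Proof.
elim: w => [|x w IH] /=.
  rewrite /word_weight big_nil mul1r.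
  by apply: eq_word_mean => v _; rewrite prefix0s mul1r drop0.
rewrite /word_weight big_cons -/(word_weight p w) -mulrA -IH.
have Z (y : bool) : y != x -> word_mean p (size w + n)
    (fun v => (prefix (x :: w) (y :: v))%:R * f (drop (size w) v)) = 0.
  move=> yx; rewrite -[RHS](word_mean_cst (size w + n)).
  by apply: eq_word_mean => v _; rewrite prefix_cons eq_sym (negbTE yx) mul0r.
have E : word_mean p (size w + n)
    (fun v => (prefix (x :: w) (x :: v))%:R * f (drop (size w) v)) =
    word_mean p (size w + n) (fun v => (prefix w v)%:R * f (drop (size w) v)).
  by apply: eq_word_mean => v _; rewrite prefix_cons eqxx.
rewrite -[LHS]/(p * word_mean p (size w + n)
    (fun v => (prefix (x :: w) (true :: v))%:R * f (drop (size w) v)) +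
  (1 - p) * word_mean p (size w + n)
    (fun v => (prefix (x :: w) (false :: v))%:R * f (drop (size w) v))).
case: x Z E => Z E; rewrite E.
  by rewrite (Z false) // mulr0 addr0.
by rewrite (Z true) // mulr0 add0r.
Qed.

(** Splits on the position [i] of the first [b] among the first [k] letters; the last term collects
    the words that begin with [k] letters [a]. *)
Lemma word_mean_runs f k N : (k <= N)%N ->
  word_mean p N f =
  \sum_(i < k) p ^+ i * (1 - p) *
    word_mean p (N - i.+1) (fun v => f (nseq i true ++ false :: v)) +
  p ^+ k * word_mean p (N - k) (fun v => f (nseq k true ++ v)).
Proof.
elim: k => [|k IH] kN; first by rewrite big_ord0 add0r expr0 mul1r subn0.
rewrite IH ?(ltnW kN) // big_ord_recr /= -addrA; congr (_ + _).
rewrite -(subnSK kN) /= mulrDr [LHS]addrC !mulrA -exprSr; congr (_ + _ * _).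
apply: eq_word_mean => v _; congr f.
by rewrite -[true :: v]cat1s catA -(nseqD k 1) addn1.
Qed.

Lemma word_mean_powL N f :
  (forall v, 0 <= f v) -> p ^+ N * f (nseq N true) <= word_mean p N f.
Proof.
move=> f0; rewrite (@word_mean_runs f N N) // subnn /= cats0 lerDr.
apply: sumr_ge0 => i _; apply: mulr_ge0.
  by rewrite mulr_ge0 ?exprn_ge0 // subr_ge0.
by rewrite -(word_mean_cst (N - i.+1) 0); apply: ler_word_mean.
Qed.

Lemma word_mean_powU N f : (forall v, f v <= 1) ->
  (forall v, false \in v -> f v = 0) -> word_mean p N f <= p ^+ N.
Proof.
move=> f1 f0; rewrite (@word_mean_runs f N N) // subnn /= cats0 big1 ?add0r.
  by rewrite ler_piMr // exprn_ge0.
move=> i _; rewrite (@eq_word_mean _ _ (fun=> 0)) ?word_mean_cst ?mulr0 // => v _.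
by rewrite f0 // mem_cat inE eqxx orbT.
Qed.

Lemma avoid_prob_ge0 w n : 0 <= avoid_prob p w n.
Proof.
by rewrite -(word_mean_cst n 0); apply: ler_word_mean => v _; case: infix.
Qed.

Lemma avoid_prob_small w n : (n < size w)%N -> avoid_prob p w n = 1.
Proof.
move=> nw; rewrite -(word_mean_cst n 1); apply: eq_word_mean => v sv.
by case: (boolP (infix w v)) => // /size_infix; rewrite sv leqNgt nw.
Qed.

(* An occurrence of [w] in [x :: v] that is not in [v] is a prefix. *)
Lemma avoid_prob_first w n : w != [::] ->
  avoid_prob p w (size w + n).-1 - word_weight p w * avoid_prob p w n <=
  avoid_prob p w (size w + n).
Proof.
case: w => // x w _; set W := x :: w.
have -> : (size W + n).-1 = (size w + n)%N by [].
rewrite /avoid_prob -word_mean_prefix.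
(* A random letter is prepended and ignored, so that all terms become averages over words of the
   same length. *)
have -> : word_mean p (size w + n) (fun v => (~~ infix W v)%:R) =
   word_mean p (size W + n) (fun v => (~~ infix W (behead v))%:R).
  by rewrite /= -mulrDl addrC subrK mul1r.
rewrite -word_meanB; apply: ler_word_mean => -[//|y v] sv.
rewrite [behead _]/= infix_consl.
have [pv|_] := boolP (prefix W (y :: v)); last by rewrite mul0r subr0.
rewrite mul1r /=; have [//|nv] := boolP (infix W v).
  by rewrite sub0r oppr_le0 ler0n.
rewrite subr_le0 ler_nat lt0b.
by apply: contra nv => /infix_trans; apply; apply: infix_drop.
Qed.
End WordMean.

(** * Occurrences of words that start with a run of [a] *)

Lemma infix_run_reset k (u v : seq bool) i : (i < k)%N ->
  infix (nseq k true ++ u) (nseq i true ++ false :: v) =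
  infix (nseq k true ++ u) v.
Proof.
(* No occurrence can start at or before this [b]: its initial run of [a] would have to cross it. *)
have P j l : (j < l)%N ->
    prefix (nseq l true ++ u) (nseq j true ++ false :: v) = false.
  elim: j l => [|j IH] [|l] //= jl; exact: IH.
elim: i => [|i IH] ik; first by rewrite infix_consl (P 0).
by rewrite infix_consl -[_ :: _]/(nseq i.+1 true ++ _) P // IH // ltnW.
Qed.

(** The occurrence ends at the first [b] of [v], which is preceded by at least [k] letters [a]. *)
Lemma infix_run_mem k (v : seq bool) : false \in v ->
  infix (nseq k true ++ [:: false]) (nseq k true ++ v).
Proof.
elim: v => // -[] v IH; last by rewrite -[false :: v]cat1s catA prefix_infix.
rewrite inE /= => /IH kv; rewrite -[true :: v]cat1s catA -(nseqD k 1) addn1.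
by rewrite infix_consl kv orbT.
Qed.

Lemma exprVn_sub (F : fieldType) (z : F) n i : z != 0 -> (i <= n)%N ->
  z ^- (n - i) = z ^- n * z ^+ i.
Proof.
by move=> z0 ni; rewrite -[X in z ^- X * _](subnK ni) exprD invfM mulfVK ?expf_neq0.
Qed.

(* The point of [z > 0] with [run_poly p k z = 1] is the exponential of the
   escape rate of [a^k]; for [a^k b] it is the smaller of that point and
   [1 / p]. *)
Definition run_poly (R : realType) (p : R) (k : nat) (z : R) : R :=
  \sum_(i < k) p ^+ i * (1 - p) * z ^+ i.+1.

(** A geometric sum. The right side is the characteristic polynomial of the recurrence; the factor
    [1 - p * z] accounts for its extra root [p^-1]. For [k = r - 1] it is [m z^r - z + 1]. *)
Lemma run_polyE (R : realType) (p : R) k z :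
  (1 - p * z) * (1 - run_poly p k z) = 1 - z + (1 - p) * p ^+ k * z ^+ k.+1.
Proof.
rewrite /run_poly; elim: k => [|k IH]; first by rewrite big_ord0; ring.
rewrite big_ord_recr /= opprD addrA mulrDr IH !exprS; ring.
Qed.

(** * Recurrences for avoidance probabilities and exponential bounds *)

Section Growth.
Variables (R : realType) (p : R).
Hypotheses (p_ge0 : 0 <= p) (p_le1 : p <= 1).
Let q_ge0 : 0 <= 1 - p. Proof. by rewrite subr_ge0. Qed.

Lemma le_run_poly j k z : 0 <= z -> (j <= k)%N ->
  run_poly p j z <= run_poly p k z.
Proof.
move=> z0 jk; rewrite -(subnKC jk) /run_poly big_split_ord /= lerDl.
by apply: sumr_ge0 => i _; rewrite !mulr_ge0 ?exprn_ge0.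
Qed.

Lemma avoid_prob_runs k (u : seq bool) j n : (j <= k)%N -> (j <= n)%N ->
  avoid_prob p (nseq k true ++ u) n =
  \sum_(i < j) p ^+ i * (1 - p) * avoid_prob p (nseq k true ++ u) (n - i.+1) +
  p ^+ j * word_mean p (n - j)
    (fun v => (~~ infix (nseq k true ++ u) (nseq j true ++ v))%:R).
Proof.
move=> jk jn; rewrite {1}/avoid_prob (word_mean_runs _ _ jn).
congr (_ + _); apply: eq_bigr => i _; congr (_ * _).
by apply: eq_word_mean => v _; rewrite infix_run_reset // (leq_trans _ jk).
Qed.

Lemma avoid_run_rec r n : (r <= n)%N ->
  avoid_prob p (nseq r true) n =
  \sum_(i < r) p ^+ i * (1 - p) * avoid_prob p (nseq r true) (n - i.+1).
Proof.
move=> rn; have := avoid_prob_runs [::] (leqnn r) rn; rewrite cats0 => ->.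
rewrite (@eq_word_mean _ _ _ _ (fun=> 0)) ?word_mean_cst ?mulr0 ?addr0 // => v _.
by rewrite prefix_infix.
Qed.

(** After a run [a^k], a word that avoids [a^k b] can only continue with [a]; this gives the term
    [p ^+ n]. Cutting the sum at [minn k n] covers short words too, so that inductions need no base
    case. *)
Lemma avoid_run_end_rec k n :
  avoid_prob p (nseq k true ++ [:: false]) n <= p ^+ n +
  \sum_(i < minn k n) p ^+ i * (1 - p) *
    avoid_prob p (nseq k true ++ [:: false]) (n - i.+1).
Proof.
rewrite [leLHS](avoid_prob_runs _ (geq_minl k n) (geq_minr k n)) addrC lerD2r.
have -> : p ^+ n = p ^+ minn k n * p ^+ (n - minn k n).
  by rewrite -exprD subnKC // geq_minr.
apply: ler_wpM2l; first exact: exprn_ge0.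
have [kn|nk] := leqP k n.
  apply: word_mean_powU => // v; first by case: infix.
  by move=> /infix_run_mem ->.
by rewrite subnn /= expr0; case: infix.
Qed.

(** [z ^- n] is a subsolution of the recurrence [avoid_run_rec], whose coefficients are nonnegative,
    and it starts below the initial values 1. *)
Lemma avoid_run_ge r z n : (0 < r)%N -> 1 <= z -> 1 <= run_poly p r z ->
  z ^- n <= avoid_prob p (nseq r true) n.
Proof.
move=> r0 z1 Qz; have z0 : 0 < z by rewrite (lt_le_trans _ z1).
elim/ltn_ind: n => n IH; have [nr|rn] := ltnP n r.
  by rewrite avoid_prob_small ?size_nseq // invf_le1 ?exprn_gt0 // exprn_ege1.
rewrite avoid_run_rec //; apply: (@le_trans _ _ (z ^- n * run_poly p r z)).
  by rewrite ler_peMr // invr_ge0 exprn_ge0 // ltW.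
rewrite /run_poly mulr_sumr; apply: ler_sum => i _.
have in' : (i.+1 <= n)%N by rewrite (leq_trans _ rn).
rewrite mulrCA -exprVn_sub ?gt_eqF //; apply: ler_wpM2l.
  by rewrite mulr_ge0 ?exprn_ge0.
by apply: IH; rewrite ltn_subrL (leq_trans _ in').
Qed.

(** The matching supersolution; the factor [z ^+ r] lifts it above the initial values 1 for
    [n < r]. *)
Lemma avoid_run_le r z n : 1 <= z -> run_poly p r z <= 1 ->
  avoid_prob p (nseq r true) n <= z ^+ r * z ^- n.
Proof.
move=> z1 Qz; have z0 : 0 < z by rewrite (lt_le_trans _ z1).
elim/ltn_ind: n => n IH; have [nr|rn] := ltnP n r.
  rewrite avoid_prob_small ?size_nseq // ler_pdivlMr ?exprn_gt0 // mul1r.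
  by rewrite ler_weXn2l // ltnW.
rewrite avoid_run_rec //.
apply: (@le_trans _ _ (z ^+ r * z ^- n * run_poly p r z)); last first.
  by rewrite ler_piMr // divr_ge0 ?exprn_ge0 // ltW.
rewrite /run_poly mulr_sumr; apply: ler_sum => i _.
have in' : (i.+1 <= n)%N by rewrite (leq_trans _ rn).
rewrite mulrCA -[z ^+ r * _ * _]mulrA -exprVn_sub ?gt_eqF //; apply: ler_wpM2l.
  by rewrite mulr_ge0 ?exprn_ge0.
by apply: IH; rewrite ltn_subrL (leq_trans _ in').
Qed.

(** The constant solves [C = 1 + C * run_poly p k z]: the 1 pays for the inhomogeneous term, as
    [p ^+ n <= z ^- n], and the rest for the sum. *)
Lemma avoid_run_end_le k z n : 0 < z -> p * z <= 1 -> run_poly p k z < 1 ->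
  avoid_prob p (nseq k true ++ [:: false]) n <=
  (1 - run_poly p k z)^-1 * z ^- n.
Proof.
move=> z0 pz Qz; set C := (_)^-1.
have C0 : 0 < C by rewrite invr_gt0 subr_gt0.
have CE : 1 + C * run_poly p k z = C.
  rewrite -[RHS]mulr1 -[1 in RHS](subrK (run_poly p k z)) mulrDr.
  by rewrite mulVf // gt_eqF // subr_gt0.
elim/ltn_ind: n => n IH; apply: (le_trans (avoid_run_end_rec k n)).
rewrite -CE mulrDl mul1r; apply: lerD.
  rewrite -[leRHS]mul1r ler_pdivlMr ?exprn_gt0 // -exprMn.
  by rewrite exprn_ile1 // mulr_ge0 // ltW.
apply: (@le_trans _ _ (C * run_poly p (minn k n) z * z ^- n)); last first.
  apply: ler_wpM2r; first by rewrite invr_ge0 exprn_ge0 // ltW.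
  apply: ler_wpM2l; first exact: ltW.
  by apply: le_run_poly; rewrite ?geq_minl // ltW.
rewrite /run_poly mulr_sumr mulr_suml; apply: ler_sum => i _.
have in' : (i.+1 <= n)%N by rewrite (leq_trans (ltn_ord i)) // geq_minr.
have -> : C * (p ^+ i * (1 - p) * z ^+ i.+1) * z ^- n =
    p ^+ i * (1 - p) * (C * (z ^- n * z ^+ i.+1)) by ring.
rewrite -exprVn_sub ?gt_eqF //.
apply: ler_wpM2l; first by rewrite mulr_ge0 ?exprn_ge0.
by apply: IH; rewrite ltn_subrL (leq_trans _ in').
Qed.

Lemma avoid_prob_ge_pow (w : seq bool) n :
  false \in w -> p ^+ n <= avoid_prob p w n.
Proof.
move=> bw; apply: le_trans (word_mean_powL p_ge0 p_le1 _ _) => //.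
case: (boolP (infix w _)) => [/mem_infix/(_ _ bw)|_ /=]; last by rewrite mulr1.
by rewrite mem_nseq andbF.
Qed.

Lemma word_weight_ge0 (w : seq bool) : 0 <= word_weight p w.
Proof. by apply: prodr_ge0 => -[]. Qed.

Lemma avoid_prob_ge (w : seq bool) z n : w != [::] -> 1 <= z ->
  word_weight p w * z ^+ size w <= z - 1 -> z ^- n <= avoid_prob p w n.
Proof.
move=> w0 z1 wz; have z0 : 0 < z by rewrite (lt_le_trans _ z1).
have sw : (0 < size w)%N by case: (w) w0.
(* Consecutive probabilities drop by a factor at most [z]. Iterating this backwards in
   [avoid_prob_first] gives [s(m+1) >= (1 - weight * z^(size w - 1)) s(m)], and the hypothesis makes
   that factor at least [1/z]. *)
suff ratio m : avoid_prob p w m <= z * avoid_prob p w m.+1.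
  elim: n => [|n IH]; first by rewrite expr0 invr1 avoid_prob_small.
  by rewrite exprS invfM ler_pdivrMl // (le_trans IH).
elim/ltn_ind: m => m IH; have [mw|wm] := ltnP m.+1 (size w).
  by rewrite !avoid_prob_small // ?mulr1 // ltnW.
have := @avoid_prob_first _ p p_ge0 p_le1 w (m.+1 - size w) w0.
rewrite subnKC //= => first.
have pow j : (j <= m)%N -> avoid_prob p w (m - j) <= z ^+ j * avoid_prob p w m.
  elim: j => [|j IHj] jm; first by rewrite subn0 expr0 mul1r.
  apply: (le_trans (IH _ _)).
    by rewrite ltn_subrL (leq_trans _ jm).
  by rewrite (subnSK jm) exprS -mulrA ler_pM2l // IHj // ltnW.
have mE : (m.+1 - size w = m - (size w).-1)%N by case: (size w) sw.
have {}pow : avoid_prob p w (m.+1 - size w) <=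
    z ^+ (size w).-1 * avoid_prob p w m.
  by rewrite mE pow // -ltnS prednK.
apply: (@le_trans _ _ (z * (avoid_prob p w m -
   word_weight p w * avoid_prob p w (m.+1 - size w)))); last first.
  by rewrite ler_pM2l.
have s0 := avoid_prob_ge0 p_ge0 p_le1 w m.
have := ler_wpM2r s0 wz.
have := ler_wpM2l (ltW z0) (ler_wpM2l (word_weight_ge0 w) pow).
rewrite -[in X in _ -> X -> _](prednK sw) exprS; nra.
Qed.

End Growth.

(** * Survivor sets as events on finitely many letters *)

Lemma infix_mkseqP (w : seq bool) (x : nat -> bool) n :
  reflect (exists2 i, (i <= n)%N & cylinder w (fun j => x (i + j)%N))
          (infix w (mkseq x (size w + n))).
Proof.
have H := @infixP _ w (mkseq x (size w + n)).
apply: (iffP H) => {H} [[s [t E]]|[i ni wx]].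
  have sE : (size w + n = size s + (size w + size t))%N.
    by rewrite -[LHS](size_mkseq x) E !size_cat.
  exists (size s) => [|j jw]; first by move: sE; lia.
  have -> : x (size s + j)%N = nth false (mkseq x (size w + n)) (size s + j).
    by rewrite nth_mkseq //; move: sE jw; lia.
  by rewrite E !nth_cat ltnNge leq_addr /= addKn jw.
exists (mkseq x i), (mkseq (fun j => x (i + size w + j)%N) (n - i)).
apply: (@eq_from_nth _ false) => [|j].
  by rewrite !size_cat !size_mkseq; lia.
rewrite size_mkseq => jn; rewrite nth_mkseq // !nth_cat !size_mkseq.
have [ji|ij] := ltnP j i; first by rewrite nth_mkseq.
have [jw|wj] := ltnP (j - i) (size w); first by rewrite -wx // subnKC.
by rewrite nth_mkseq; [congr x|]; lia.
Qed.

Lemma iter_left_shift i (x : sequence_space) j :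
  iter i left_shift x j = x (i + j)%N.
Proof. by elim: i j => [|i IH] j //=; rewrite /left_shift IH addnS. Qed.

(** The shifts [0..n] together inspect exactly the first [size w + n] letters. *)
Lemma survivorE (w : seq bool) n :
  survivor w n =
  [set x : sequence_space | ~~ infix w (mkseq (x : nat -> bool) (size w + n))].
Proof.
apply/seteqP; split => x /=.
  move=> Sx; apply/infix_mkseqP => -[i ni wx]; apply: (Sx i ni) => j jw /=.
  by rewrite iter_left_shift wx.
move=> /infix_mkseqP wx i ni Hx; apply: wx; exists i => // j jw.
by rewrite -iter_left_shift Hx.
Qed.

Lemma measurable_cylinder u :
  measurable (cylinder u : set sequence_space).
Proof. by apply: sub_gen_smallest; exists u. Qed.

Lemma cylinder_rcons u b :
  cylinder (rcons u b) = cylinder u `&` [set x | x (size u) = b].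
Proof.
apply/seteqP; split => x /=.
  move=> ux; split; last by rewrite ux ?size_rcons // nth_rcons ltnn eqxx.
  by move=> i iu; rewrite ux ?size_rcons 1?ltnW // nth_rcons iu.
move=> [ux xb] i; rewrite size_rcons ltnS nth_rcons leq_eqVlt.
by case: ltngtP => //= [/ux //|-> _].
Qed.

Section ProductMeasure.
Variables (R : realType) (p : R) (mu : probability sequence_space R).
Hypothesis hmu : is_product_measure p mu.

(** The fixed prefix [u] makes this family of events stable under conditioning on the next letter,
    which is what the induction on [n] needs. *)
Definition cylinder_event u n (P : pred (seq bool)) : set sequence_space :=
  cylinder u `&`
  [set x : sequence_space |
     P (mkseq (fun j => (x : nat -> bool) (size u + j)%N) n)].

Lemma cylinder_eventS u n P :
  cylinder_event u n.+1 P =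
  cylinder_event (rcons u true) n (fun v => P (true :: v)) `|`
  cylinder_event (rcons u false) n (fun v => P (false :: v)).
Proof.
have E (x : nat -> bool) : mkseq (fun j => x (size u + j)%N) n.+1 =
    x (size u) :: mkseq (fun j => x ((size u).+1 + j)%N) n.
  rewrite /mkseq -[n.+1]add1n iotaD /= addn0; congr (_ :: _).
  by rewrite (iotaDl 1 0) -map_comp; apply: eq_map => j /=; rewrite addnA addn1.
rewrite /cylinder_event !cylinder_rcons !size_rcons.
apply/seteqP; split => x /=.
  by rewrite E; case xu: (x (size u)) => -[ux Px]; [left|right].
by rewrite E => -[] [[ux ->] Px].
Qed.

(** Measurability is carried along with the value because additivity in the induction step requires
    it. *)
Lemma cylinder_event_prob u n P :
  measurable (cylinder_event u n P) /\
  mu (cylinder_event u n P) =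
    (word_weight p u * word_mean p n (fun v => (P v)%:R))%:E.
Proof.
elim: n u P => [|n IH] u P.
  rewrite /cylinder_event /=; case: (P [::]).
    rewrite (_ : [set _ | true] = setT) ?setIT ?mulr1; last first.
      by apply/funext => x; apply/propext; split.
    by split; [exact: measurable_cylinder | exact: hmu].
  rewrite (_ : [set _ | false] = set0) ?setI0 ?mulr0 ?measure0; last first.
    by apply/funext => x; apply/propext; split.
  by split => //; exact: measurable0.
have [mt et] := IH (rcons u true) (fun v => P (true :: v)).
have [mf ef] := IH (rcons u false) (fun v => P (false :: v)).
rewrite cylinder_eventS; split; first exact: measurableU.
rewrite measureU //.
  transitivity (mu (cylinder_event (rcons u true) n (fun v => P (true :: v))) +
    mu (cylinder_event (rcons u false) n (fun v => P (false :: v))))%E => //.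
  rewrite et ef -EFinD /word_weight !big_rcons /= /bernoulli_pmf.
  by congr EFin; ring.
rewrite /cylinder_event !cylinder_rcons; apply/seteqP; split => // x /=.
by move=> [[[_ ->] _] [[]]].
Qed.

Lemma survivor_prob (w : seq bool) n :
  mu (survivor w n) = (avoid_prob p w (size w + n))%:E.
Proof.
have [_] := cylinder_event_prob [::] (size w + n) (fun v => ~~ infix w v).
rewrite /word_weight big_nil mul1r => <-; rewrite survivorE; congr (mu _).
by apply/seteqP; split => x /=; [move=> wx; split|case].
Qed.
End ProductMeasure.

(** * Escape rates from exponential bounds *)

Lemma le_limn_einf (R : realType) (u v : nat -> \bar R) :
  (forall n, (0 < n)%N -> (u n <= v n)%E) -> (limn_einf u <= limn_einf v)%E.
Proof.
move=> uv; rewrite !limn_einf_lim; apply: lee_lim; try exact: is_cvg_einfs.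
exists 1%N => // n /= n1; apply: le_ereal_inf_tmp => _ [m /= nm <-].
by apply: le_trans (uv m (leq_trans n1 nm)); apply: ereal_inf_lbound; exists m.
Qed.

(** Multiplicative constants and the offset [size w] in the length contribute only terms [c / n] to
    the rate. *)
Lemma limn_einf_affine_inv (R : realType) (a c : R) :
  limn_einf (fun n => (a + c / n%:R)%:E) = a%:E.
Proof.
apply: (cvg_limn_einf_sup _).1; apply/cvg_EFin; first exact: nearW.
rewrite -[X in _ --> X]addr0; apply: cvgD; first exact: cvg_cst.
rewrite -[X in _ --> X](mulr0 c); apply: cvgMr.
apply/gtr0_cvgV0; first by exists 1%N => // n /= n0; rewrite ltr0n.
exact: cvgr_idn.
Qed.

Section EscapeRate.
Variables (R : realType) (p : R) (mu : probability sequence_space R).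
Hypothesis hmu : is_product_measure p mu.

Lemma escape_rate_le (w : seq bool) z : 0 < z ->
  (forall n, z ^- n <= avoid_prob p w n) -> (escape_rate mu w <= (ln z)%:E)%E.
Proof.
move=> z0 wz; rewrite -(limn_einf_affine_inv (ln z) ((size w)%:R * ln z)).
apply: le_limn_einf => n n0; rewrite (survivor_prob hmu).
have zN0 N : 0 < z ^- N by rewrite invr_gt0 exprn_gt0.
have s0 := lt_le_trans (zN0 _) (wz (size w + n)%N).
rewrite lne_EFin // -EFinN inver pnatr_eq0 gtn_eqF // -EFinM lee_fin.
have nR : 0 < n%:R :> R by rewrite ltr0n.
rewrite ler_pdivrMr // mulrDl divfK ?gt_eqF // lerNl.
have := wz (size w + n)%N.
rewrite -ler_ln ?posrE // lnV ?posrE ?exprn_gt0 // lnXn //.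
rewrite -[ln z *+ _]mulr_natl natrD.
by apply: le_trans; rewrite lerN2; lra.
Qed.

Lemma escape_rate_ge (w : seq bool) z C : 0 < z -> 0 < C ->
  (forall n, avoid_prob p w n <= C * z ^- n) ->
  ((ln z)%:E <= escape_rate mu w)%E.
Proof.
move=> z0 C0 wz.
rewrite -(limn_einf_affine_inv (ln z) ((size w)%:R * ln z - ln C)).
apply: le_limn_einf => n n0; rewrite (survivor_prob hmu).
have nR : 0 < n%:R :> R by rewrite ltr0n.
rewrite inver pnatr_eq0 gtn_eqF //.
(* For a null survivor set the logarithm is [-oo], so the term of the rate is [+oo]. *)
have [s0|s0] := leP (avoid_prob p w (size w + n)) 0.
  by rewrite le0_lneNy ?lee_fin //= gt0_mulye ?leey // lte_fin invr_gt0.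
rewrite lne_EFin // -EFinN -EFinM lee_fin.
rewrite ler_pdivlMr // mulrDl divfK ?gt_eqF // lerNr.
have := wz (size w + n)%N.
have zN0 : 0 < z ^- (size w + n) by rewrite invr_gt0 exprn_gt0.
rewrite -ler_ln ?posrE ?mulr_gt0 // lnM ?posrE // lnV ?posrE ?exprn_gt0 //.
rewrite lnXn // -[ln z *+ _]mulr_natl natrD => /le_trans; apply; lra.
Qed.

(** Lets [C] depend on [z], since it may blow up as [z] tends to [T]. *)
Lemma escape_rate_ge_lt (w : seq bool) T : 0 < T ->
  (forall z, 0 < z -> z < T -> exists2 C, 0 < C &
    forall n, avoid_prob p w n <= C * z ^- n) ->
  ((ln T)%:E <= escape_rate mu w)%E.
Proof.
move=> T0 wz; apply/lee_subgt0Pr => e e0.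
have x0 : 0 < T * expR (- e) by rewrite mulr_gt0 // expR_gt0.
have [|C C0 wC] := wz _ x0.
  by rewrite gtr_pMr // expR_lt1 oppr_lt0.
have := escape_rate_ge x0 C0 wC.
by rewrite lnM ?posrE ?expR_gt0 // expRK EFinD EFinN.
Qed.
End EscapeRate.

(** * Power inequalities and the weight of a word *)

Lemma ler_expr_tangent (R : realDomainType) (x y : R) n : 0 <= x -> 0 <= y ->
  x ^+ n.+1 + n.+1%:R * x ^+ n * (y - x) <= y ^+ n.+1.
Proof.
move=> x0 y0; elim: n => [|n IH]; first by rewrite !expr1 expr0 !mul1r addrC subrK.
rewrite [leRHS]exprS; apply: le_trans (ler_wpM2l y0 IH).
rewrite -subr_ge0; set d := (X in 0 <= X).
have -> : d = n.+1%:R * x ^+ n * (y - x) ^+ 2.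
  by rewrite /d -(natr1 n.+1) !exprS; ring.
by apply: mulr_ge0 (sqr_ge0 _); rewrite mulr_ge0 ?exprn_ge0.
Qed.

Lemma ler_expr_1Dx2 (R : realFieldType) (t : R) n : 0 <= t ->
  1 + n%:R * t + n%:R * (n%:R - 1) / 2 * t ^+ 2 <= (1 + t) ^+ n.
Proof.
move=> t0; elim: n => [|n IH]; first by rewrite expr0 !mul0r !addr0.
have t1 : 0 <= 1 + t by rewrite addr_ge0.
rewrite [leRHS]exprS; apply: le_trans (ler_wpM2l t1 IH).
rewrite -subr_ge0; set d := (X in 0 <= X).
have -> : d = n%:R * (n%:R - 1) / 2 * t ^+ 3.
  by rewrite /d -(natr1 n); field.
apply: mulr_ge0 (exprn_ge0 _ t0); apply: divr_ge0 => //.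
by case: n {IH d} => [|n]; rewrite ?mul0r // mulr_ge0 // subr_ge0 ler1n.
Qed.

(** As [p >= 1/2], turning every letter but one [b] into [a] cannot decrease the weight. *)
Lemma word_weight_le (R : realType) (p : R) (w : seq bool) :
  2^-1 <= p -> p <= 1 -> false \in w ->
  word_weight p w <= p ^+ (size w).-1 * (1 - p).
Proof.
move=> hp hp1; have p0 : 0 <= p by apply: le_trans hp; rewrite invr_ge0.
have q0 : 0 <= 1 - p by rewrite subr_ge0.
have le_pow v : word_weight p v <= p ^+ size v.
  rewrite /word_weight; elim: v => [|x v IH]; first by rewrite big_nil.
  rewrite big_cons /= exprS ler_pM //; first by case: x.
  - by apply: prodr_ge0 => -[].
  - by case: x => //=; lra.
elim: w => // -[] w IH.
  rewrite inE /= => bw; rewrite /word_weight big_cons /=.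
  have s0 : (0 < size w)%N by case: (w) bw.
  by rewrite -[size w]prednK // exprS -mulrA ler_wpM2l // IH.
by move=> _; rewrite /word_weight big_cons /= mulrC ler_wpM2r // le_pow.
Qed.

Lemma notin_nseq (w : seq bool) : false \notin w -> w = nseq (size w) true.
Proof.
move=> bw; apply/all_pred1P/allP => -[] //= bw'.
by rewrite bw' in bw.
Qed.

(** * The quadratic truncation behind [gamma_bar] *)

Section Quadratic.
Variables (R : realType) (p : R) (r : nat).
Hypotheses (hp : 2^-1 <= p) (hp1 : p < 1) (hr : (2 <= r)%N).
Let m := p ^+ r.-1 * (1 - p).
(** With [t = z - 1], the truncation [quad] has leading coefficient [A / 2] and discriminant [D], so
    its smaller root is [(1 - r%:R * m - Num.sqrt D) / A]. *)
Let A := r%:R * (r%:R - 1) * m.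
Let D := 1 - r%:R * m * (2 + (r%:R - 2) * m).
Let quad t := m * (1 + r%:R * t + r%:R * (r%:R - 1) / 2 * t ^+ 2) - t.

Let p0 : 0 < p. Proof. by apply: lt_le_trans hp; rewrite invr_gt0. Qed.
Let q0 : 0 < 1 - p. Proof. by rewrite subr_gt0. Qed.
Let m0 : 0 < m. Proof. by rewrite mulr_gt0 // exprn_gt0. Qed.
Let r2 : 2 <= r%:R :> R. Proof. by rewrite ler_nat. Qed.
Let A0 : 0 < A. Proof.
have r1 : 0 < r%:R - 1 :> R by have := r2; lra.
by rewrite mulr_gt0 ?m0 // mulr_gt0 //; have := r2; lra.
Qed.

Let A2 : 0 < 2 * A. Proof. by have := A0; lra. Qed.

Let quadE t : 2 * A * quad t = (1 - r%:R * m - A * t) ^+ 2 - D.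
Proof. by rewrite /A /D /quad; field. Qed.

Lemma quad_le t : 0 <= t -> quad t <= m * (1 + t) ^+ r - t.
Proof. by move=> t0; rewrite lerD2r ler_pM2l // ler_expr_1Dx2. Qed.

Lemma root_inv : m * p^-1 ^+ r = p^-1 - 1.
Proof.
have pn : p != 0 by rewrite gt_eqF.
have -> : p^-1 ^+ r = p ^- r.-1 * p^-1.
  by rewrite -exprVn -exprSr prednK // ltnW.
rewrite /m mulrACA mulfV ?expf_neq0 // mul1r mulrBl mul1r mulfV //.
Qed.

Let quad_inv : quad (p^-1 - 1) <= 0.
Proof.
have t0 : 0 <= p^-1 - 1 by rewrite subr_ge0 invf_ge1 // ltW.
by apply: le_trans (quad_le t0) _; rewrite [1 + _]addrC subrK root_inv subrr.
Qed.

(** A quadratic with positive leading coefficient and a nonpositive value, here at [p^-1 - 1], has a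
    real root. *)
Let D_ge0 : 0 <= D.
Proof.
have : 2 * A * quad (p^-1 - 1) <= 0 by rewrite pmulr_rle0 ?quad_inv.
rewrite quadE subr_le0; apply: le_trans; exact: sqr_ge0.
Qed.

Let gammaE : A * (gamma_bar p r - 1) = 1 - r%:R * m - Num.sqrt D.
Proof.
rewrite /gamma_bar -/m -/A -/D mulrBr mulrCA mulfV ?gt_eqF // !mulr1 /A; ring.
Qed.

Let quad_gt0 t : t < gamma_bar p r - 1 -> 0 < quad t.
Proof.
rewrite -(ltr_pM2l A0) gammaE ltrBrDr -ltrBrDl => sD.
rewrite -(pmulr_rgt0 _ A2) quadE subr_gt0 -(sqr_sqrtr D_ge0).
by rewrite ltr_pXn2r // ?nnegrE ?sqrtr_ge0 // (le_trans (sqrtr_ge0 D)) // ltW.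
Qed.

Lemma gamma_bar_le : gamma_bar p r <= p^-1.
Proof.
rewrite leNgt; apply/negP => gp; have := quad_inv.
by rewrite leNgt quad_gt0 // ltrD2r.
Qed.

(** The smaller root of [quad] is nonnegative: [quad_inv] forces [r m <= 1], and [quad 0 = m > 0]
    gives [D <= (1 - r m)^2]. *)
Lemma gamma_bar_ge1 : 1 <= gamma_bar p r.
Proof.
have t0 : 0 < p^-1 - 1 by rewrite subr_gt0 invf_gt1.
have rm : 0 <= 1 - r%:R * m.
  rewrite -(pmulr_lge0 _ t0); have := quad_inv; rewrite /quad.
  have : 0 <= A / 2 * (p^-1 - 1) ^+ 2.
    by rewrite mulr_ge0 ?sqr_ge0 // divr_ge0 // ltW.
  rewrite /A; have := m0; nra.
rewrite -subr_ge0 -(pmulr_rge0 _ A0) gammaE subr_ge0.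
rewrite -(ler_pXn2r (ltn0Sn 1)) ?nnegrE ?sqrtr_ge0 // sqr_sqrtr //.
have : 0 <= 2 * A * m by rewrite mulr_ge0 // ltW ?A2 ?m0.
by have := quadE 0; rewrite /quad; lra.
Qed.

Lemma gamma_bar_gt z : 0 < z -> z < gamma_bar p r -> 0 < 1 - z + m * z ^+ r.
Proof.
move=> z0 zg; have [z1|z1] := leP z 1.
  by apply: ltr_wpDl; [lra | rewrite mulr_gt0 // exprn_gt0].
have t0 : 0 <= z - 1 by lra.
have := lt_le_trans (quad_gt0 _) (quad_le t0); rewrite ltrD2r => /(_ zg).
by rewrite [1 + _]addrC subrK; lra.
Qed.
End Quadratic.

(** * Bounds on the maximal escape rate *)

Section MaxEscapeRate.
Variables (R : realType) (p : R) (mu : probability sequence_space R) (r : nat).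
Hypotheses (hp : 2^-1 <= p) (hp1 : p < 1) (hmu : is_product_measure p mu).
Hypothesis hr : (2 <= r)%N.
Let p0 : 0 < p. Proof. by apply: lt_le_trans hp; rewrite invr_gt0. Qed.
Let q0 : 0 < 1 - p. Proof. by rewrite subr_gt0. Qed.
Let pge0 : 0 <= p. Proof. exact: ltW. Qed.
Let ple1 : p <= 1. Proof. exact: ltW. Qed.
Let r0 : (0 < r)%N. Proof. exact: ltnW. Qed.
Let rR : 0 < r%:R :> R. Proof. by rewrite ltr0n. Qed.
Let pV1 : 1 <= p^-1. Proof. by rewrite invf_ge1. Qed.

Lemma max_escape_rate_ge (w : seq bool) :
  size w = r -> (escape_rate mu w <= max_escape_rate mu r)%E.
Proof.
move=> /eqP sw.
exact: (le_bigmax _ (fun w : r.-tuple bool => escape_rate mu w) (Tuple sw)).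
Qed.

Lemma max_escape_rate_le B :
  (forall w : seq bool, size w = r -> false \in w ->
    (escape_rate mu w <= B)%E) ->
  (escape_rate mu (nseq r true) <= B)%E -> (max_escape_rate mu r <= B)%E.
Proof.
move=> wB aB; apply: bigmax_le => [|w _]; first by rewrite leNye.
have [/wB|/notin_nseq ->] := boolP (false \in val w); rewrite size_tuple //.
exact.
Qed.

Lemma escape_rate_le_inv (w : seq bool) :
  false \in w -> (escape_rate mu w <= (ln p^-1)%:E)%E.
Proof.
move=> bw; apply: (escape_rate_le hmu) => [|n]; first by rewrite invr_gt0.
by rewrite -exprVn invrK avoid_prob_ge_pow.
Qed.

Lemma escape_rate_run_le z : 1 <= z -> 1 <= run_poly p r z ->
  (escape_rate mu (nseq r true) <= (ln z)%:E)%E.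
Proof.
move=> z1 Qz; apply: (escape_rate_le hmu) => [|n]; first exact: lt_le_trans z1.
exact: avoid_run_ge.
Qed.

Lemma max_escape_rate_ge_run_end T : 0 < T ->
  (forall z, 0 < z -> z < T -> p * z <= 1 /\ run_poly p r.-1 z < 1) ->
  ((ln T)%:E <= max_escape_rate mu r)%E.
Proof.
move=> T0 QT; pose w := nseq r.-1 true ++ [:: false].
apply: (@le_trans _ _ (escape_rate mu w)).
  apply: (escape_rate_ge_lt hmu) => // z z0 zT; have [pz Qz] := QT z z0 zT.
  exists (1 - run_poly p r.-1 z)^-1; first by rewrite invr_gt0 subr_gt0.
  by move=> n; apply: avoid_run_end_le.
by apply: max_escape_rate_ge; rewrite size_cat size_nseq addn1 prednK.
Qed.

Lemma run_poly_inv k : run_poly p k p^-1 = k%:R * (1 - p) / p.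
Proof.
rewrite /run_poly (eq_bigr (fun=> (1 - p) / p)) => [|i _].
  by rewrite big_const_ord iter_addr_0 -mulrA mulr_natl.
rewrite exprS exprVn [p ^+ i * _]mulrC mulrACA.
by rewrite mulfV ?mulr1 ?expf_neq0 ?gt_eqF.
Qed.

(** For [p z < 1] each of the [r - 1] terms of [run_poly] is at most [(1 - p) z], and the hypothesis
    says [(r - 1)(1 - p) <= p]; the sum is thus at most [p z]. *)
Lemma max_escape_rate_ge_inv : r%:R * (1 - p) <= 1 ->
  ((ln p^-1)%:E <= max_escape_rate mu r)%E.
Proof.
move=> rq; apply: max_escape_rate_ge_run_end => [|z z0 zp].
  by rewrite invr_gt0.
have pz : p * z < 1 by rewrite mulrC -ltr_pdivlMr // mul1r.
split; first exact: ltW.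
apply: le_lt_trans (pz); apply: (@le_trans _ _ (\sum_(i < r.-1) (1 - p) * z)).
  apply: ler_sum => i _.
  have -> : p ^+ i * (1 - p) * z ^+ i.+1 = (p * z) ^+ i * ((1 - p) * z).
    by rewrite exprMn exprS; ring.
  by rewrite ler_piMl ?exprn_ile1 ?mulr_ge0 // ltW.
rewrite big_const_ord iter_addr_0 -mulr_natl mulrA ler_wpM2r ?(ltW z0) //.
by move: rq; rewrite -[in r%:R](prednK r0) -natr1; lra.
Qed.

Lemma max_escape_rate_le_inv : p <= r%:R * (1 - p) ->
  (max_escape_rate mu r <= (ln p^-1)%:E)%E.
Proof.
move=> prq; apply: max_escape_rate_le => [w _|]; first exact: escape_rate_le_inv.
by apply: escape_rate_run_le => //; rewrite run_poly_inv ler_pdivlMr // mul1r.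
Qed.

Lemma max_escape_rate_le_tangent : 1 < r%:R * (1 - p) ->
  (max_escape_rate mu r <=
    (1 / (r%:R - 1) * ln (1 / (r%:R * p ^+ r.-1 * (1 - p))))%:E)%E.
Proof.
move=> rq; set c := r%:R * p ^+ r.-1 * (1 - p).
have c0 : 0 < c by rewrite !mulr_gt0 // exprn_gt0.
(* The critical point of [m z^r - z + 1], where [r m z^(r-1) = 1]. *)
set z := expR (1 / (r%:R - 1) * ln (1 / c)).
have z0 : 0 < z := expR_gt0 _.
have cz : c * z ^+ r.-1 = 1.
  have rE : r.-1%:R = r%:R - 1 :> R by rewrite -[in r%:R](prednK r0) -natr1 addrK.
  have r1 : r%:R - 1 != 0 :> R by rewrite subr_eq0 pnatr_eq1 gtn_eqF.
  rewrite /z -expRM_natl rE [1 / (_ - _)]div1r mulVKf //.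
  by rewrite div1r lnK ?posrE ?invr_gt0 // mulfV ?gt_eqF.
(* The critical equation reads [r (1 - p) (p z)^(r-1) = 1], whose first factor exceeds 1. *)
have pz : p * z < 1.
  rewrite ltNge; apply/negP => pz; have := exprn_ege1 r.-1 pz.
  have : 1 = r%:R * (1 - p) * (p * z) ^+ r.-1 by rewrite -[LHS]cz exprMn /c; ring.
  nra.
(* By convexity the critical value is at most the value at [p^-1], which is 0. *)
have tangent : p ^+ r.-1 * (1 - p) * z ^+ r <= z - 1.
  have := ler_expr_tangent r.-1 (ltW z0) (le_trans ler01 pV1).
  rewrite prednK // => /(ler_wpM2l (ltW (mulr_gt0 (exprn_gt0 r.-1 p0) q0))).
  rewrite root_inv // mulrDr.
  have -> : p ^+ r.-1 * (1 - p) * (r%:R * z ^+ r.-1 * (p^-1 - z)) = p^-1 - z.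
    by rewrite -[RHS]mul1r -[in RHS]cz /c; ring.
  by lra.
have z1 : 1 <= z.
  have : 0 <= p ^+ r.-1 * (1 - p) * z ^+ r.
    by rewrite ltW // !mulr_gt0 // exprn_gt0.
  by lra.
rewrite -[X in X%:E]expRK -/z; apply: max_escape_rate_le => [w sw bw|].
  apply: (escape_rate_le hmu) => // n; apply: avoid_prob_ge => //.
    by apply: contraTneq bw => ->.
  apply: le_trans tangent; rewrite sw ler_wpM2r ?exprn_ge0 ?(ltW z0) //.
  by rewrite -sw word_weight_le.
apply: escape_rate_run_le => //.
(* For [a^r], the identity [run_polyE] has right side [1 - z + p z * m z^r], which is nonpositive by
   [tangent] and [p z < 1]. *)
have pz1 : 0 < 1 - p * z by rewrite subr_gt0.
rewrite -subr_le0 -(pmulr_rle0 _ pz1) run_polyE.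
have -> : (1 - p) * p ^+ r * z ^+ r.+1 = p * z * (p ^+ r.-1 * (1 - p) * z ^+ r).
  by rewrite -[r in p ^+ r]prednK // !exprS; ring.
have : 0 <= p ^+ r.-1 * (1 - p) * z ^+ r by rewrite ltW // !mulr_gt0 // exprn_gt0.
by nra.
Qed.

Lemma max_escape_rate_ge_gamma_bar :
  ((ln (gamma_bar p r))%:E <= max_escape_rate mu r)%E.
Proof.
have g1 := gamma_bar_ge1 hp hp1 hr; have gp := gamma_bar_le hp hp1 hr.
apply: max_escape_rate_ge_run_end => [|z z0 zg]; first exact: lt_le_trans g1.
have pz : p * z < 1 by rewrite mulrC -ltr_pdivlMr // mul1r (lt_le_trans zg).
have pz1 : 0 < 1 - p * z by rewrite subr_gt0.
split; first exact: ltW.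
rewrite -subr_gt0 -(pmulr_rgt0 _ pz1) run_polyE prednK // [_ * p ^+ _]mulrC.
exact: gamma_bar_gt.
Qed.

Lemma max_escape_rate_ge_run : r.+1%:R * (1 - p) < 1 ->
  ((ln (1 / p) + 1 / r%:R * ln (1 / (r.+1%:R * (1 - p))))%:E <=
   max_escape_rate mu r)%E.
Proof.
move=> rq; set c := r.+1%:R * (1 - p).
have c0 : 0 < c by rewrite mulr_gt0 // ltr0n.
(* [z = y / p] is the critical point of [(1 - p) p^r z^(r+1) - z + 1]. Now [y > 1], so [z] lies
   beyond the root [p^-1] and [1 - p z] is negative. *)
set y := expR (1 / r%:R * ln (1 / c)).
have y1 : 1 < y by rewrite expR_gt1 mulr_gt0 ?ln_gt0 ?div1r ?invr_gt0 ?invf_gt1.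
have cy : c * y ^+ r = 1.
  rewrite /y -expRM_natl [1 / r%:R]div1r mulVKf ?gt_eqF //.
  by rewrite div1r lnK ?posrE ?invr_gt0 // mulfV ?gt_eqF.
have y0 : 0 < y by exact: lt_trans y1.
have -> : ln (1 / p) + 1 / r%:R * ln (1 / c) = ln (y / p).
  by rewrite lnM ?posrE ?invr_gt0 // expRK addrC [1 / p]div1r.
set z := y / p.
have z1 : 1 <= z by rewrite /z mulr_ege1 ?pV1 // ltW.
have z0 : 0 < z by apply: lt_le_trans z1.
have pz : p * z = y by rewrite /z mulrCA mulfV ?mulr1 // gt_eqF.
apply: (@le_trans _ _ (escape_rate mu (nseq r true))); last first.
  by apply: max_escape_rate_ge; rewrite size_nseq.
apply: (@escape_rate_ge _ _ _ hmu _ z (z ^+ r)) => // [|n].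
  exact: exprn_gt0.
apply: avoid_run_le => //; have pz1 : 1 - p * z < 0 by rewrite pz subr_lt0.
rewrite -subr_ge0 -(nmulr_rle0 _ pz1) run_polyE.
have := ler_expr_tangent r (ltW z0) (le_trans ler01 pV1).
move=> /(ler_wpM2l (ltW (mulr_gt0 q0 (exprn_gt0 r p0)))).
have -> : (1 - p) * p ^+ r * p^-1 ^+ r.+1 = p^-1 - 1.
  rewrite exprSr exprVn mulrA mulfK ?expf_neq0 ?gt_eqF //.
  by rewrite mulrBl mul1r mulfV // gt_eqF.
rewrite mulrDr.
have -> : (1 - p) * p ^+ r * (r.+1%:R * z ^+ r * (p^-1 - z)) = p^-1 - z.
  rewrite -[RHS]mul1r -[in RHS]cy -[in RHS]pz [(p * z) ^+ r]exprMn /c.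
  by ring.
by lra.
Qed.

(* The bound is the escape rate of [aa]: [run_poly p 2] takes the value 1 at its
   exponential. *)
Lemma max_escape_rate_le_double_run : 3 * (1 - p) <= 1 ->
  (max_escape_rate mu r <=
    (ln ((- 1 + p + Num.sqrt ((1 - p) ^+ 2 + 4 * p * (1 - p)))
                 / (2 * p * (1 - p))))%:E)%E.
Proof.
move=> q3; set D := _ ^+ 2 + _; set z := _ / _.
have D0 : 0 <= D by rewrite addr_ge0 ?sqr_ge0 // !mulr_ge0 // ltW.
have a0 : 0 < 2 * p * (1 - p) by rewrite !mulr_gt0.
have zE : 2 * p * (1 - p) * z = - 1 + p + Num.sqrt D.
  by rewrite /z mulrCA mulfV ?mulr1 // gt_eqF.
have zeq : (1 - p) * z + p * (1 - p) * z ^+ 2 = 1.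
  have pq : 4 * p * (1 - p) != 0 by rewrite gt_eqF // !mulr_gt0.
  apply: (mulfI pq); have := sqr_sqrtr D0.
  have -> : Num.sqrt D = 2 * p * (1 - p) * z + 1 - p by rewrite zE; ring.
  rewrite /D => E; lra.
(* So that the bound also covers the words containing [b]. It reduces to [9 q^2 <= D] with
   [q = 1 - p], and [D - 9 q^2 = 4 q (1 - 3 q)]. *)
have zp : p^-1 <= z.
  rewrite -(ler_pM2l a0) zE [2 * p]mulrC -!mulrA.
  have -> : p * (2 * ((1 - p) / p)) = 2 * (1 - p) by field; rewrite gt_eqF.
  have : 3 * (1 - p) <= Num.sqrt D; last by lra.
  have sq : 0 <= 3 * (1 - p) by rewrite mulr_ge0 // ltW.
  rewrite -(ger0_norm sq) -sqrtr_sqr ler_wsqrtr // /D.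
  by have := q0; nra.
have z1 : 1 <= z by apply: le_trans zp.
apply: max_escape_rate_le => [w _ bw|].
  apply: le_trans (escape_rate_le_inv bw) _.
  by rewrite lee_fin ler_ln ?posrE ?invr_gt0 // (lt_le_trans _ z1).
apply: escape_rate_run_le => //.
apply: (le_trans _ (le_run_poly pge0 ple1 (le_trans ler01 z1) hr)).
by rewrite /run_poly !big_ord_recl big_ord0 /= expr0 expr1 /bump /=; lra.
Qed.
End MaxEscapeRate.

Theorem corollary3p9 (R : realType) (p : R) (hp : 2^-1 <= p) (hp1 : p < 1)
    (mu : probability sequence_space R) (hmu : is_product_measure p mu)
    (r : nat) (hr : (2 <= r)%N) :
  [/\ p \in `[2^-1, 1 - r%:R^-1[ ->
        max_escape_rate mu r \in
          `[(ln (gamma_bar p r))%:E,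
            (1 / (r%:R - 1) * ln (1 / (r%:R * p ^+ r.-1 * (1 - p))))%:E],
      p \in `[1 - r%:R^-1, 1 - r.+1%:R^-1] ->
        max_escape_rate mu r = (ln (1 / p))%:E
    & p \in `]1 - r.+1%:R^-1, 1[ ->
        max_escape_rate mu r \in
          `[(ln (1 / p) + 1 / r%:R * ln (1 / (r.+1%:R * (1 - p))))%:E,
            (ln ((- 1 + p + Num.sqrt ((1 - p) ^+ 2 + 4 * p * (1 - p)))
                 / (2 * p * (1 - p))))%:E]].
Proof.
have r0 : 0 < r%:R :> R by rewrite ltr0n ltnW.
have r10 : 0 < r.+1%:R :> R by rewrite ltr0n.
(* The interval ends [1 - 1/n] become conditions on [n (1 - p)]. *)
have le_inv (n : R) : 0 < n -> (1 - n^-1 <= p) = (n * (1 - p) <= 1).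
  by move=> n0; rewrite lerBlDr -lerBlDl -[n^-1]mul1r ler_pdivlMr // mulrC.
have ge_inv (n : R) : 0 < n -> (p <= 1 - n^-1) = (1 <= n * (1 - p)).
  by move=> n0; rewrite lerBrDl -lerBrDr -[n^-1]mul1r ler_pdivrMr // mulrC.
rewrite !in_itv /=; split.
- case/andP=> _; rewrite ltNge le_inv // -ltNge => rq.
  by rewrite max_escape_rate_ge_gamma_bar // max_escape_rate_le_tangent.
- rewrite le_inv // ge_inv // => /andP[rq r1q]; rewrite div1r.
  apply/eqP; rewrite eq_le max_escape_rate_ge_inv // max_escape_rate_le_inv //.
  (* [1 <= (r + 1)(1 - p)] is the same as [p <= r (1 - p)]. *)
  by move: r1q; rewrite -natr1; lra.
- case/andP; rewrite ltNge ge_inv // -ltNge => rq _.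
  rewrite max_escape_rate_ge_run // max_escape_rate_le_double_run //.
  apply: le_trans (ltW rq); rewrite ler_wpM2r ?subr_ge0 ?(ltW hp1) //.
  by rewrite ler_nat.
Qed.
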